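(* For the undirected greedy routing network creation game on any finite point set $\mathcal P\subset\mathbb R^2$ ($|\mathcal P|\ge2$) with the Euclidean metric, every pure Nash equilibrium $\mathbf s$ satisfies $c(\mathbf s)\le 1.8\cdot c(\mathbf s^* )$, where $\mathbf s^*$ is a social optimum. That is, the Price of Anarchy is at most $1.8$.
   Context: Undirected variant of the game: $\mathcal P$ is a finite set of points (agents) with metric $d$; each agent $u$ chooses a strategy $S_u\subseteq\{\{u,v\}:v\in\mathcal P\setminus\{u\}\}$ of undirected edges, which it owns; a profile $\mathbf s$ induces the network $G(\mathbf s)$ on $\mathcal P$ in which $\{u,v\}$ is an edge iff $\{u,v\}\in S_u\cup S_v$. A greedy routing path from $u$ to $w$ is a path $(x_1=u,\dots,x_j=w)$ in $G(\mathbf s)$ with $d(x_i,w)>d(x_{i+1},w)$ for all $i$; $u$ is greedy connected if it has a greedy routing path to every other agent. The cost of $u$ is $c_u(\mathbf s)=|S_u|$ if $u$ is greedy connected and $\infty$ otherwise; social cost $c(\mathbf s)=\sum_u c_u(\mathbf s)$. A pure Nash equilibrium is a profile where no agent can strictly decrease its cost by a unilateral deviation; a social optimum minimizes social cost. The Price of Anarchy is the worst-case ratio $c(\mathbf s)/c(\mathbf s^* )$ over Nash equilibria $\mathbf s$ (and instances). *)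

(* Defs.v *)
From Stdlib Require Import Reals.
From mathcomp Require Import all_boot all_order all_algebra.
From mathcomp Require Import Rstruct.

Set Implicit Arguments.
Unset Strict Implicit.
Unset Printing Implicit Defensive.

Import Order.TTheory GRing.Theory Num.Theory.

Section GreedyRouting.

(* Agents form a finite type [T]; [pos] places them in the plane R^2.
   Injectivity of [pos] means the agents are a finite point set P ⊂ R^2. *)
Variables (T : finType) (pos : T -> (R * R)%type).

Definition edist (u v : T) : R :=
  sqrt (Rplus (pow (Rminus (fst (pos u)) (fst (pos v))) 2)
              (pow (Rminus (snd (pos u)) (snd (pos v))) 2)).

(* A strategy profile: s u is the set of agents v such that u buys (owns)
   the undirected edge {u,v}; hence |S_u| = #|s u|. *)
Definition profile := {ffun T -> {set T}}.

Definition valid_strategy (u : T) (S : {set T}) : bool := u \notin S.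
Definition valid_profile (s : profile) : bool :=
  [forall u, valid_strategy u (s u)].

Definition edge (s : profile) (u v : T) : bool := (v \in s u) || (u \in s v).

Definition greedy_step (s : profile) (w : T) : rel T :=
  fun x y => edge s x y && (edist y w < edist x w)%R.

Definition greedy_reach (s : profile) (u w : T) : bool :=
  connect (greedy_step s w) u w.

Definition greedy_connected (s : profile) (u : T) : bool :=
  [forall w, (w != u) ==> greedy_reach s u w].

(* Extended naturals: None = infinity. *)
Definition enat := option nat.

Definition eadd (x y : enat) : enat :=
  match x, y with Some a, Some b => Some (a + b) | _, _ => None end.

Definition ele (x y : enat) : bool :=
  match x, y with
  | _, None => true
  | None, Some _ => false
  | Some a, Some b => a <= b
  end.

Definition elt (x y : enat) : bool := ele x y && (x != y).

(* multiplication by a natural constant k > 0 (k * infinity = infinity) *)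
Definition escale (k : nat) (x : enat) : enat :=
  match x with Some a => Some (k * a) | None => None end.

Definition agent_cost (s : profile) (u : T) : enat :=
  if greedy_connected s u then Some #|s u| else None.

Definition social_cost (s : profile) : enat :=
  \big[eadd/Some 0]_(u : T) agent_cost s u.

Definition deviate (s : profile) (u : T) (S : {set T}) : profile :=
  [ffun v => if v == u then S else s v].

Definition nash_equilibrium (s : profile) : Prop :=
  valid_profile s /\
  forall (u : T) (S : {set T}), valid_strategy u S ->
    ~~ elt (agent_cost (deviate s u S) u) (agent_cost s u).

Definition social_optimum (s : profile) : Prop :=
  valid_profile s /\
  forall s' : profile, valid_profile s' -> ele (social_cost s) (social_cost s').

End GreedyRouting.

(* Main.v *)
Require Import Defs.
From Stdlib Require Import Reals.
From mathcomp Require Import all_boot all_order all_algebra.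
From mathcomp Require Import Rstruct.
From mathcomp Require Import zify ring lra.

(* Let two agents be forced neighbours if one of them is a nearest agent of the
   other; these edges lie in every network where all agents are greedy
   connected. Let [r u] be the least number of neighbours that [u] needs besides
   its forced ones; a sector argument around a nearest neighbour of [u] gives
   [r u <= 4]. With [F] forced edges and [R] the sum of the [r u], every such
   network has at least [F + R / 2] edges, whereas in an equilibrium each forced
   edge is paid at most once and so the cost is at most [F + R]. Each agent has
   a forced neighbour, so [R <= 4 n <= 8 F] and the ratio is at most [9 / 5]. *)

Set Implicit Arguments.
Unset Strict Implicit.
Unset Printing Implicit Defensive.

Import Order.TTheory GRing.Theory Num.Theory.

Lemma social_costE (T : finType) (pos : T -> (R * R)%type) (s : profile T) :
  social_cost pos s =
  if [forall u, greedy_connected pos s u] then Some (\sum_u #|s u|) else None.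
Proof.
rewrite /social_cost.
have -> : [forall u, greedy_connected pos s u] =
          all (greedy_connected pos s) (index_enum T).
  apply/forallP/allP => [h u _ | h u]; first exact: h.
  exact/h/mem_index_enum.
elim: (index_enum T) => [|u r IH]; first by rewrite !big_nil.
rewrite !big_cons IH /agent_cost /=.
by case: (greedy_connected pos s u); case: (all _ r).
Qed.

(** * Covering sets and forced edges *)

Section Covering.

Variables (T : finType) (pos : T -> (R * R)%type).
Implicit Types (s : profile T) (u v w : T) (A S X : {set T}).

Local Notation d := (edist pos).

Definition neighbours s u : {set T} := [set v | edge s u v].

(** What greedy routing demands of the neighbours of [u] alone: a first step towards every
    target. *)
Definition covering u A : bool :=
  [forall w, (w != u) ==> [exists x in A, (d x w < d u w)%R]].

Lemma coveringP u A :
  reflect (forall w, w != u -> exists2 x, x \in A & (d x w < d u w)%R)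
          (covering u A).
Proof.
apply: (iffP forallP) => h w.
  by move=> wu; have /implyP/(_ wu)/exists_inP[x xA xw] := h w; exists x.
by apply/implyP=> /h[x xA xw]; apply/exists_inP; exists x.
Qed.

Lemma covering_sub u A X : A \subset X -> covering u A -> covering u X.
Proof.
move=> AX /coveringP h; apply/coveringP => w /h[x xA xw].
by exists x => //; apply: (subsetP AX).
Qed.

Lemma covering_setD1 u A : covering u A -> covering u (A :\ u).
Proof.
move=> /coveringP h; apply/coveringP => w /h[x xA xw].
exists x => //; rewrite !inE xA andbT.
by apply: contraTneq xw => ->; rewrite ltxx.
Qed.

Lemma greedy_connected_covering s u :
  greedy_connected pos s u -> covering u (neighbours s u).
Proof.
move=> /forallP h; apply/coveringP => w wu.
have /implyP/(_ wu)/connectP[[|x p] /=] := h w.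
  by move=> _ e; rewrite e eqxx in wu.
by case/andP=> /andP[ux xw] _ _; exists x => //; rewrite inE.
Qed.

Lemma path_deviate s u S w x p : (d x w < d u w)%R ->
  path (greedy_step pos s w) x p ->
  path (greedy_step pos (deviate s u S) w) x p.
Proof.
elim: p x => [|y p IH] x //= xu /andP[/andP[xy yx] yp].
have yu : (d y w < d u w)%R by apply: lt_trans yx xu.
rewrite IH // andbT /greedy_step yx andbT.
have ne z : (d z w < d u w)%R -> (z == u) = false.
  by move=> zu; apply/negbTE; apply: contraTneq zu => ->; rewrite ltxx.
by rewrite /edge !ffunE !ne.
Qed.

(* Distances to the target decrease along a greedy path, so a path starting
   closer to the target than [u] never meets [u] and survives its deviation. *)
Lemma greedy_connected_deviate s u S A :
  (forall x, greedy_connected pos s x) -> covering u A ->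
  A \subset neighbours (deviate s u S) u ->
  greedy_connected pos (deviate s u S) u.
Proof.
move=> h /coveringP cA sA; apply/forallP => w; apply/implyP => wu.
have [x xA xw] := cA w wu.
have ux : edge (deviate s u S) u x by have := subsetP sA x xA; rewrite inE.
apply: (@connect_trans _ _ x); first by apply: connect1; rewrite /greedy_step ux.
have [<-|wx] := eqVneq w x; first exact: connect0.
have /forallP/(_ w)/implyP/(_ wx)/connectP[p pp e] := h x.
by apply/connectP; exists p => //; apply: path_deviate pp.
Qed.

Definition nearest u v : bool :=
  (v != u) && [forall w, (w != u) ==> (d u v <= d u w)%R].

Definition forced u : {set T} := [set v | nearest u v || nearest v u].

Lemma forced_sym u v : (u \in forced v) = (v \in forced u).
Proof. by rewrite !inE orbC. Qed.

Lemma edge_sym s u v : edge s u v = edge s v u.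
Proof. by rewrite /edge orbC. Qed.

Lemma edistC u v : d u v = d v u.
Proof. by rewrite /edist; congr (sqrt _); rewrite /= !RminusE !RplusE !RmultE; ring. Qed.

(* If [v] is nearest to [u], then only [u] itself is closer to [u] than [v],
   so [v] cannot do without the edge to [u]. *)
Lemma nearest_edge s u v :
  greedy_connected pos s v -> nearest u v -> edge s v u.
Proof.
move=> /greedy_connected_covering/coveringP h /andP[vu /forallP n].
have [|x] := h u; first by rewrite eq_sym.
rewrite inE => vx xu; have [<- //|xNu] := eqVneq x u.
have /implyP/(_ xNu) := n x.
by rewrite edistC [d u x]edistC leNgt xu.
Qed.

Lemma forced_sub_neighbours s u :
  (forall x, greedy_connected pos s x) -> forced u \subset neighbours s u.
Proof.
move=> h; apply/subsetP => v; rewrite !inE => /orP[] n.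
  by rewrite edge_sym; apply: nearest_edge n.
exact: nearest_edge n.
Qed.

Lemma exists_nearest u : 1 < #|T| -> exists v, nearest u v.
Proof.
move=> T2; have : 0 < #|[set~ u]| by rewrite cardsC1; lia.
case/card_gt0P => v0; rewrite !inE => v0u.
case: (@arg_minP _ _ _ v0 (fun v => v != u) (d u) v0u) => v vu vmin.
by exists v; rewrite /nearest vu; apply/forallP => w; apply/implyP/vmin.
Qed.

Lemma card_forced_gt0 u : 1 < #|T| -> 0 < #|forced u|.
Proof. by case/(exists_nearest u) => v n; apply/card_gt0P; exists v; rewrite inE n. Qed.

End Covering.

(** * Sectors of 60 degrees *)

Section Sectors.

Local Open Scope ring_scope.

Variable K : realFieldType.
Implicit Types (c x y : K) (i : 'I_4).

(* [p] and [q] are the coordinates along the two rays bounding a half-open 60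
   degree sector, so the angle is below 60 degrees: [4 D^2 > N N'], with
   [N N' = D^2 + C^2] for the dot product [D] and the cross product [C]. *)
Lemma sector_dot_gt (c x y x' y' p q p' q' : K) : c ^+ 2 = 3 ->
  0 <= p -> 0 < q -> 0 <= p' -> 0 < q' ->
  6 * (x * x' + y * y') = 2 * p * p' + 2 * q * q' + p * q' + q * p' ->
  2 * c * (x * y' - x' * y) = p * q' - q * p' ->
  x ^+ 2 + y ^+ 2 <= x' ^+ 2 + y' ^+ 2 ->
  x ^+ 2 + y ^+ 2 < 2 * (x * x' + y * y').
Proof.
move=> c2 p0 q0 p'0 q'0.
have pp' : 0 <= p * p' by apply: mulr_ge0.
have qq' : 0 < q * q' by apply: mulr_gt0.
have pq' : 0 <= p * q' by apply: mulr_ge0 => //; apply: ltW.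
have qp' : 0 <= q * p' by apply: mulr_ge0 => //; apply: ltW.
set D := x * x' + y * y'; set C := x * y' - x' * y => eD eC.
have lagrange : (x ^+ 2 + y ^+ 2) * (x' ^+ 2 + y' ^+ 2) = D ^+ 2 + C ^+ 2.
  by rewrite /D /C; ring.
move=> N; have N0 : 0 <= x ^+ 2 + y ^+ 2 by rewrite addr_ge0 ?sqr_ge0.
have D0 : 0 <= D by lra.
have CD : C ^+ 2 < 3 * D ^+ 2.
  have -> : 3 * D ^+ 2 = (6 * D) ^+ 2 / 12 by field.
  have -> : C ^+ 2 = (2 * c * C) ^+ 2 / 12 by rewrite !exprMn c2; field.
  (* Both factors of the difference of squares are positive because [0 < q * q']. *)
  rewrite eD eC ltr_pM2r ?invr_gt0 ?ltr0n // -subr_gt0 subr_sqr.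
  by rewrite mulr_gt0 //; lra.
(* After squaring, the left side is at most the product of the two squared norms, which is
   [D ^+ 2 + C ^+ 2 < 4 * D ^+ 2]. *)
rewrite -(ltr_pXn2r (n := 2)) ?nnegrE //; last lra.
apply: le_lt_trans (_ : (x ^+ 2 + y ^+ 2) * (x' ^+ 2 + y' ^+ 2) < _).
  by rewrite expr2 ler_wpM2l.
by rewrite lagrange exprMn; lra.
Qed.

(** With [c] the square root of 3, sector [i] holds the directions from [60 + 60 * i] (excluded) to
    [120 + 60 * i] (included) degrees. *)
Definition axes (c : K) (i : 'I_4) (x y : K) : K * K :=
  match val i with
  | 0 => (y + c * x, y - c * x)
  | 1 => (2 * y, - (c * x) - y)
  | 2 => (y - c * x, - (2 * y))
  | _ => (- (c * x) - y, c * x - y)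
  end.

Definition in_sector c i x y : bool :=
  (0 <= (axes c i x y).1) && (0 < (axes c i x y).2).

Lemma in_sector_dot_gt c i x y x' y' : c ^+ 2 = 3 ->
  in_sector c i x y -> in_sector c i x' y' ->
  x ^+ 2 + y ^+ 2 <= x' ^+ 2 + y' ^+ 2 ->
  x ^+ 2 + y ^+ 2 < 2 * (x * x' + y * y').
Proof.
move=> c2 /andP[p0 q0] /andP[p'0 q'0].
apply: (sector_dot_gt c2 p0 q0 p'0 q'0).
  suff e : c * x * (c * x') = 3 * (x * x').
    by case: i {p0 q0 p'0 q'0} => [[|[|[|i]]] ?]; rewrite /axes /=; nra.
  by rewrite -c2; ring.
by case: i {p0 q0 p'0 q'0} => [[|[|[|i]]] ?]; rewrite /axes /=; ring.
Qed.

(* The hypotheses say that (x, y) makes an angle of more than 60 degrees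
   with the positive x-axis; the remaining 240 degrees split into 4 sectors. *)
Lemma in_sector_cover c x y : 0 < c -> c ^+ 2 = 3 ->
  0 < x ^+ 2 + y ^+ 2 -> x <= 0 \/ 3 * x ^+ 2 < y ^+ 2 ->
  exists i, in_sector c i x y.
Proof.
move=> c0 c2 n0 wide.
have ccx : (c * x) ^+ 2 = 3 * x ^+ 2 by rewrite exprMn c2.
have sq (a b : K) : 0 <= b -> a ^+ 2 < b ^+ 2 -> a < b.
  move=> b0; rewrite !ltNge; apply: contra => ba.
  by rewrite ler_sqr ?nnegrE // (le_trans b0).
have cx0 : x <= 0 -> c * x <= 0 by move=> x0; rewrite pmulr_rle0.
have [y0|y0|y0] := ltgtP y 0.
- have lt2 : c * x < - y.
    by case: wide => [/cx0|]; [lra | rewrite -ccx -[y ^+ 2]sqrrN; apply: sq; lra].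
  have [le1|lt1] := leP (c * x) y.
    by exists (@Ordinal 4 2 isT); rewrite /in_sector /axes /=; lra.
  by exists (@Ordinal 4 3 isT); rewrite /in_sector /axes /=; lra.
- have lt2 : c * x < y.
    by case: wide => [/cx0|]; [lra | rewrite -ccx; apply: sq; lra].
  have [le1|lt1] := leP (- (c * x)) y.
    by exists (@Ordinal 4 0 isT); rewrite /in_sector /axes /=; lra.
  by exists (@Ordinal 4 1 isT); rewrite /in_sector /axes /=; lra.
(* Only the direction of 180 degrees is left, the closed end of sector 1. *)
- have x0 : x < 0.
    rewrite y0 expr0n /= addr0 in n0 wide.
    case: wide => [|]; last by have := sqr_ge0 x; lra.
    by rewrite le_eqVlt => /orP[/eqP x0|//]; move: n0; rewrite x0 expr0n ltxx.
  have : c * x < 0 by rewrite pmulr_rlt0.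
  by exists (@Ordinal 4 1 isT); rewrite /in_sector /axes /=; lra.
Qed.

End Sectors.

(** * Euclidean geometry around an agent *)

Section Plane.

Local Open Scope ring_scope.

Variables (T : finType) (pos : T -> (R * R)%type).
Hypothesis pos_inj : injective pos.
Implicit Types u v w x : T.

Let px u w : R := ((pos w).1 - (pos u).1)%R.
Let py u w : R := ((pos w).2 - (pos u).2)%R.
(** Up to the common factor [edist pos u v], [dot u v w] and [cross u v w] are the coordinates of
    [w] in the frame with origin [u] and first axis through [v]. *)
Let dot u v w : R := (px u v * px u w + py u v * py u w)%R.
Let cross u v w : R := (px u v * py u w - py u v * px u w)%R.

Lemma dot_ge0 u v : 0 <= dot u v v.
Proof. by rewrite /dot -!expr2 addr_ge0 ?sqr_ge0. Qed.

Lemma edist_sqrt u v : edist pos u v = Num.sqrt (dot u v v).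
Proof.
rewrite -RsqrtE ?dot_ge0 // /edist; congr (sqrt _).
by rewrite /dot /px /py !RminusE !RplusE !RpowE; ring.
Qed.

Lemma dot_gt0 u v : v != u -> 0 < dot u v v.
Proof.
move=> vu; rewrite lt_neqAle dot_ge0 andbT eq_sym; apply: contra vu.
rewrite /dot -!expr2 paddr_eq0 ?sqr_ge0 // !sqrf_eq0 /px /py !subr_eq0.
case/andP => /eqP e1 /eqP e2; apply/eqP/pos_inj.
by rewrite [LHS]surjective_pairing e1 e2 -surjective_pairing.
Qed.

Lemma edist_le u v w : (edist pos u v <= edist pos u w) = (dot u v v <= dot u w w).
Proof. by rewrite !edist_sqrt ler_sqrt // dot_ge0. Qed.

(** Law of cosines at [u]. *)
Lemma edist_closer u x w : w != u ->
  (edist pos x w < edist pos u w) = (dot u x x < 2 * dot u x w).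
Proof.
move=> wu; rewrite !edist_sqrt ltr_sqrt ?dot_gt0 //.
have -> : dot x w w = dot u w w - (2 * dot u x w - dot u x x).
  by rewrite /dot /px /py; ring.
by rewrite ltrBlDr ltrDl subr_gt0.
Qed.

(* In coordinates with [v] on the positive x-axis, points not covered by the
   nearest neighbours of [u] make an angle of more than 60 degrees with [v];
   in each 60 degree sector the point closest to [u] covers all the others. *)
Lemma forced_covering u : (1 < #|T|)%N ->
  exists2 X : {set T}, (#|X| <= 4)%N & covering pos u (forced pos u :|: X).
Proof.
case/(exists_nearest pos u) => v vn; case/andP: (vn) => vu /forallP vmin.
have V0 := dot_gt0 vu.
have c2 : Num.sqrt 3 ^+ 2 = 3 :> R by rewrite sqr_sqrtr ?ler0n.
have c0 : 0 < Num.sqrt 3 :> R by rewrite sqrtr_gt0 ltr0n.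
pose inS i w := in_sector (Num.sqrt 3) i (dot u v w) (cross u v w).
have norm w : dot u v w ^+ 2 + cross u v w ^+ 2 = dot u v v * dot u w w.
  by rewrite /dot /cross; ring.
have dots x w : dot u v x * dot u v w + cross u v x * cross u v w
              = dot u v v * dot u x w.
  by rewrite /dot /cross; ring.
have rep i : exists x, forall w, inS i w -> inS i x && (dot u x x <= dot u w w).
  (* In an empty sector the claim is vacuous, and [u] serves as a default. *)
  have [w0 w0i|none] := pickP (inS i); last by exists u => w; rewrite none.
  case: (arg_minP (fun w => dot u w w) w0i) => x xi xmin.
  by exists x => w /xmin; rewrite xi.
have [f fP] := fin_all_exists rep.
exists [set f i | i : 'I_4].
  by apply: leq_trans (leq_imset_card _ _) _; rewrite card_ord.
apply/coveringP => w wu.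
have [vw|vw] := boolP (edist pos v w < edist pos u w).
  by exists v => //; rewrite !inE vn.
(* If [w] is no farther from [u] than [v], it is itself nearest to [u], hence forced, and covers
   itself. *)
have [wv|vltw] := leP (dot u w w) (dot u v v).
  exists w; last by rewrite edist_closer //; have := dot_gt0 wu; lra.
  rewrite !inE /nearest wu /=; apply/orP; left; apply/orP; left.
  apply/forallP => z; apply/implyP => zu.
  have /implyP/(_ zu) := vmin z; rewrite !edist_le; exact: le_trans.
(* Now [2 * dot u v w <= dot u v v < dot u w w], so the cosine of the angle at [u] is below 1/2. *)
rewrite edist_closer // -leNgt in vw.
have W0 := dot_gt0 wu.
have [||i wi] := @in_sector_cover _ _ (dot u v w) (cross u v w) c0 c2.
- by rewrite norm mulr_gt0.
- have [x0|x0] := leP (dot u v w) 0; [by left | right].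
  by have := norm w; nra.
have /andP[xi xw] := fP i w wi.
exists (f i); first by rewrite inE imset_f ?orbT.
rewrite edist_closer //.
have := in_sector_dot_gt c2 xi wi; rewrite !norm dots ler_pM2l // => /(_ xw).
by rewrite mulrCA ltr_pM2l.
Qed.

End Plane.

(** * Counting edges in equilibria and optima *)

Section PriceOfAnarchy.

Variables (T : finType) (pos : T -> (R * R)%type).
Implicit Types (s : profile T) (u v : T) (S X : {set T}).

Hypothesis pos_inj : injective pos.
Hypothesis T_gt1 : 1 < #|T|.

(** The size of such an [X] is the number [r u]. *)
Lemma minimal_forced_covering u : exists X : {set T},
  [/\ #|X| <= 4, covering pos u (forced pos u :|: X) &
      forall Y : {set T}, covering pos u (forced pos u :|: Y) -> #|X| <= #|Y|].
Proof.
have [X0 X04 cX0] := forced_covering pos_inj u T_gt1.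
pose P (X : {set T}) := covering pos u (forced pos u :|: X).
case: (@arg_minnP _ X0 P (fun X => #|X|) cX0) => X cX Xmin.
by exists X; split=> //; apply: leq_trans X04; apply: Xmin.
Qed.

(** The unforced neighbours complete the forced ones to a covering set, so there are at least [#|X|]
    of them. *)
Lemma card_neighbours_covering s u X : (forall x, greedy_connected pos s x) ->
  (forall Y : {set T}, covering pos u (forced pos u :|: Y) -> #|X| <= #|Y|) ->
  #|forced pos u| + #|X| <= #|neighbours s u|.
Proof.
move=> sc Xmin; have FN := forced_sub_neighbours u sc.
rewrite -(cardsID (forced pos u) (neighbours s u)) (setIidPr FN) leq_add2l.
apply/Xmin/(covering_sub _ (greedy_connected_covering (sc u))).
apply/subsetP => v vN; rewrite in_setU in_setD vN andbT; exact: orbN.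
Qed.

Lemma sum_card_sym (F G : T -> {set T}) : (forall u v, (u \in F v) = (v \in G u)) ->
  \sum_u #|F u| = \sum_u #|G u|.
Proof.
move=> FG; under eq_bigr do rewrite -sum1_card big_mkcond.
rewrite exchange_big; apply: eq_bigr => u _.
rewrite -sum1_card [RHS]big_mkcond; by apply: eq_bigr => v _; rewrite FG.
Qed.

(** Each purchase creates at most one neighbour at either end. *)
Lemma sum_card_neighbours s : \sum_u #|neighbours s u| <= 2 * \sum_u #|s u|.
Proof.
pose I u := [set v | u \in s v].
have <- : \sum_u (#|s u| + #|I u|) = 2 * \sum_u #|s u|.
  rewrite big_split /= mul2n -addnn; congr (_ + _).
  by apply: sum_card_sym => u v; rewrite inE.
apply: leq_sum => u _; apply: leq_trans (leq_card_setU _ _); apply: subset_leq_card.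
by apply/subsetP => v; rewrite !inE.
Qed.

(** Buying all edges reaches every target in one step, so an infinite cost can always be
    improved. *)
Lemma nash_greedy_connected s u :
  nash_equilibrium pos s -> greedy_connected pos s u.
Proof.
case=> _ /(_ u [set~ u]); rewrite /valid_strategy !inE eqxx => /(_ isT).
rewrite /agent_cost; case: (greedy_connected pos s u) => //.
have -> : greedy_connected pos (deviate s u [set~ u]) u; last by [].
apply/forallP => w; apply/implyP => wu; apply: connect1.
rewrite /greedy_step /edge !ffunE eqxx !inE wu /= edist_closer //.
by have := dot_gt0 pos_inj wu; lra.
Qed.

(* A best response need only buy the forced edges not already bought by the
   other endpoint, and complete the forced neighbours to a covering set. *)
Lemma nash_card_le s u X : nash_equilibrium pos s ->
  covering pos u (forced pos u :|: X) ->
  #|s u| <= #|[set v in forced pos u | u \notin s v]| + #|X|.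
Proof.
move=> ns cX; have sc x := nash_greedy_connected x ns.
set F' := [set v in _ | _].
(* Removing [u] makes the strategy valid and keeps the covering, as [u] is never closer than
   itself. *)
pose S := (F' :|: X) :\ u.
have Sc : greedy_connected pos (deviate s u S) u.
  apply: (greedy_connected_deviate sc (covering_setD1 cX)).
  apply/subsetP => v; rewrite in_setD1 in_setU [v \in neighbours _ _]inE /edge !ffunE eqxx.
  case/andP=> /negbTE vu; rewrite vu /S in_setD1 in_setU vu /=.
  case/orP => [vF|->]; last by rewrite orbT.
  rewrite [v \in F']inE vF /=; by case: (u \in s v); rewrite ?orbT.
have := ns.2 u S; rewrite /valid_strategy !inE eqxx => /(_ isT).
rewrite /agent_cost Sc sc ffunE eqxx /elt /= => no.
have le : #|S| <= #|F'| + #|X|.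
  apply: leq_trans (leq_card_setU _ _); exact/subset_leq_card/subsetDl.
apply: leq_trans le; rewrite leqNgt; apply: contra no => lt.
by rewrite (ltnW lt) /=; apply: contraTneq lt => -[->]; rewrite ltnn.
Qed.

(** Every forced edge is bought by some end, so at most one end finds it unbought by the other,
    while the right side counts it at both. *)
Lemma sum_card_unbought_forced s : (forall x, greedy_connected pos s x) ->
  2 * \sum_u #|[set v in forced pos u | u \notin s v]| <= \sum_u #|forced pos u|.
Proof.
move=> sc; rewrite mul2n -addnn.
rewrite {2}(@sum_card_sym _ (fun u => [set v in forced pos u | v \notin s u]));
  last by move=> u v; rewrite !inE orbC.
rewrite -big_split /=; apply: leq_sum => u _.
rewrite -(cardsID [set v | u \notin s v] (forced pos u)) leq_add //; apply: subset_leq_card.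
  by apply/subsetP => v; rewrite !inE.
apply/subsetP => v; rewrite !in_setD !inE => /andP[vF vs].
have := subsetP (forced_sub_neighbours u sc) v.
rewrite !inE => /(_ vF); rewrite /edge (negbTE vs) /= => ->.
by rewrite vF.
Qed.

End PriceOfAnarchy.

Theorem mainTheorem12 (T : finType) (pos : T -> (R * R)%type)
  (pos_inj : injective pos) (hcard : 2 <= #|T|)
  (s sopt : profile T) :
  nash_equilibrium pos s -> social_optimum pos sopt ->
  ele (escale 5 (social_cost pos s)) (escale 9 (social_cost pos sopt)).
Proof.
move=> ns _; rewrite !social_costE.
have sc x := nash_greedy_connected pos_inj x ns.
have -> : [forall u, greedy_connected pos s u] by apply/forallP.
have [/forallP oc|//] := boolP [forall u, greedy_connected pos sopt u].
have [X /all_and3[X4 cX Xmin]] := fin_all_exists (minimal_forced_covering pos_inj hcard).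
have nash_le : \sum_u #|s u| <=
    \sum_u #|[set v in forced pos u | u \notin s v]| + \sum_u #|X u|.
  by rewrite -big_split /=; apply: leq_sum => u _; apply: (nash_card_le pos_inj).
have opt_ge : \sum_u #|forced pos u| + \sum_u #|X u| <= 2 * \sum_u #|sopt u|.
  apply: leq_trans (sum_card_neighbours sopt); rewrite -big_split /=.
  by apply: leq_sum => u _; exact: card_neighbours_covering oc (Xmin u).
have X_le : \sum_u #|X u| <= 4 * \sum_u #|forced pos u|.
  rewrite big_distrr /=; apply: leq_sum => u _; apply: leq_trans (X4 u) _.
  by rewrite leq_pmulr ?card_forced_gt0.
(* With [f] the sum of the [#|forced pos u|] (twice the number of forced edges) and [R] that of the
   [#|X u|], ten times the equilibrium cost is at most [5 f + 10 R <= 9 f + 9 R], by [R <= 4 f], and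
   this is at most 18 times the optimum. *)
have := sum_card_unbought_forced sc.
by rewrite /=; lia.
Qed.
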